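(* Let $n$ be an even positive integer. Then the image of the map $\mathbb{F}_{2^n}\to\mathbb{F}_{2^n}$, $x\mapsto x^3+x$, is $$\mathrm{Im}(x^3+x)=Y^{(n)}=\{0\}\sqcup Y_1^{(n)}\sqcup Y_3^{(n)},$$ where $$Y_1^{(n)}=\{\xi\in\mathbb{F}_{2^n}\setminus\{0\}\mid \mathrm{Tr}(\xi^{-1})=1\},$$ $$Y_3^{(n)}=\{r^3+r^{-3}\mid r\in\mathbb{F}_{2^n},\ r\neq 0\}=\{s+s^{-1}\mid s\in U_{(2^n-1)/3}\}.$$
   Context: $Y^{(n)}$ denotes the image of $x\mapsto x^3+x$ on $\mathbb{F}_{2^n}$. For $x\in\mathbb{F}_{2^n}$, $\mathrm{Tr}(x)=\sum_{i=0}^{n-1}x^{2^i}$ is the absolute trace, with values in $\mathbb{F}_2=\{0,1\}$. For $i\in\{0,1,3\}$, $Y_i^{(n)}$ denotes the set of $\xi\in\mathbb{F}_{2^n}$ such that the polynomial $x^3+x-\xi$ has exactly $i$ distinct roots in $\mathbb{F}_{2^n}$; the displayed formulas for $Y_1^{(n)}$ and $Y_3^{(n)}$ are part of the assertion. $U_d=\{x\mid x^d=1\}$ is the group of $d$-th roots of unity; here $U_{(2^n-1)/3}\subset\mathbb{F}_{2^n}^*$ (for even $n$, $3$ divides $2^n-1$). The symbol $\sqcup$ denotes disjoint union.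
   Formalization: The first displayed equality for Y_3 is corrected to Y_3 = {r^3 + r^{-3} | r ≠ 0} \ {0}: r = 1 gives 0, but x^3 + x has exactly 2 distinct roots, so 0 is not in Y_3; all other clauses are unchanged. *)

(* Defs.v *)
From mathcomp Require Import all_boot all_order all_algebra all_field.

Set Implicit Arguments.
Unset Strict Implicit.
Unset Printing Implicit Defensive.

Import GRing.Theory.
Local Open Scope ring_scope.

(* The field F_{2^n} is represented by an arbitrary finite field F with
   #|F| = (2 ^ n)%N. *)

Definition cubic_image (F : finFieldType) : {set F} :=
  [set x ^+ 3 + x | x : F].

(* The set Y_i of all xi for which X^3 + X - xi has exactly i distinct roots
   in F; roots are counted without multiplicity.  In characteristic 2,
   X^3 + X = X (X + 1)^2 has exactly two roots, so 0 is in Y_2, although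
   0 = r^3 + r^-3 whenever r^3 = 1. *)
Definition Yset (F : finFieldType) (i : nat) : {set F} :=
  [set xi : F | #|[set x : F | root ('X^3 + 'X - xi%:P) x]| == i].

(* This is the absolute trace when #|F| = (2 ^ n)%N; its values 0 and 1 are
   read in the prime subfield of F. *)
Definition abs_trace (F : finFieldType) (n : nat) (x : F) : F :=
  \sum_(i < n) x ^+ (2 ^ i).

Definition Uroots (F : finFieldType) (d : nat) : {set F} :=
  [set x : F | x ^+ d == 1].

(* Main.v *)
Require Import Defs.
From mathcomp Require Import all_boot all_order all_algebra all_field.
From mathcomp Require Import ring.

(* If xi = a^3 + a with xi nonzero, the other roots are a y with
   y^2 + y = 1 + 1/a^2.  By additive Hilbert 90 they lie in F iff
   Tr(1/a) = 0, since Tr(1) = 0 for even n.  Moreover Tr(1/xi) = Tr(1/a).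
   That every nonzero xi with Tr(1/xi) = 1 has a root follows because
   a |-> a^3 + a is injective on the finite set {a | Tr(1/a) = 1} and
   preserves it.  The roots with Tr(1/a) = 0 are exactly the r + 1/r, on
   which the cubic takes the value r^3 + 1/r^3. *)

Import GRing.Theory.
Local Open Scope ring_scope.

(** * Counting fibers and roots *)

Lemma imset_eq_fiber_bound (T U : finType) (f : T -> U) (D : {set T})
    (S : {set U}) (k : nat) :
    (0 < k)%N -> f @: D \subset S -> (#|S| * k <= #|D|)%N ->
    (forall y, #|[set x in D | f x == y]| <= k)%N ->
  f @: D = S.
Proof.
move=> k_gt0 fDS leSD fib; apply/eqP; rewrite eqEcard fDS -(leq_pmul2r k_gt0).
(* [D] is partitioned by its fibers over the image, each of size at most [k], so the image has at
   least [#|D| / k] elements, hence at least [#|S|]. *)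
apply: leq_trans leSD _; rewrite -sum1_card (partition_big_imset f) /=.
rewrite -sum_nat_const; apply: leq_sum => y _; apply: leq_trans (fib y).
rewrite -sum1_card (eq_bigl [in [set x in D | f x == y]]) // => x.
by rewrite inE.
Qed.

Lemma card_root_le (F : finFieldType) (p : {poly F}) (k : nat) :
  size p = k.+1 -> (#|[set x | root p x]| <= k)%N.
Proof.
move=> sz; have p0 : p != 0 by rewrite -size_poly_eq0 sz.
have := max_poly_roots (rs := enum [set x | root p x]) p0.
rewrite -cardE sz ltnS; apply; last exact: enum_uniq.
by apply/allP => x; rewrite mem_enum inE.
Qed.

Lemma natr2_pchar2 (F : fieldType) : 2%N \in [pchar F] -> 2%:R = 0 :> F.
Proof. by move=> /pcharf0. Qed.

Lemma sqrD_id (R : comNzRingType) (y : R) : y ^+ 2 + y = y * (y + 1).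
Proof. by ring. Qed.

(** * The absolute trace *)

Lemma abs_traceD (F : finFieldType) (n : nat) :
    2%N \in [pchar F] ->
  {morph @abs_trace F n : x y / x + y}.
Proof.
move=> ch2 x y; rewrite /abs_trace -big_split; apply: eq_bigr => i _.
by rewrite exprDn_pchar // pnatX pnatE // ch2.
Qed.

(** Squaring permutes the summands cyclically, because x^(2^n) = x. *)
Lemma abs_trace_sqr (F : finFieldType) (n : nat) (x : F) :
  #|F| = (2 ^ n)%N -> abs_trace n (x ^+ 2) = abs_trace n x.
Proof.
move=> cardF; case: n cardF => [|m] cardF.
  by rewrite /abs_trace !big_ord0.
rewrite /abs_trace big_ord_recr [RHS]big_ord_recl /= -exprM -expnS -cardF.
rewrite expf_card expr1 addrC; congr (_ + _); apply: eq_bigr => i _.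
by rewrite -exprM -expnS.
Qed.

Lemma sqr_abs_trace (F : finFieldType) (n : nat) (x : F) :
    2%N \in [pchar F] ->
  abs_trace n x ^+ 2 = abs_trace n (x ^+ 2).
Proof.
move=> ch2; rewrite /abs_trace; elim: n => [|n IHn].
  by rewrite !big_ord0 expr0n.
by rewrite !big_ord_recr /= -IHn exprDn_pchar ?pnatE // -!exprM mulnC.
Qed.

(** The trace t satisfies t^2 = t, and a field has no idempotents besides 0 and 1. *)
Lemma abs_trace_neq1 (F : finFieldType) (n : nat) (x : F) :
  #|F| = (2 ^ n)%N -> (abs_trace n x != 1) = (abs_trace n x == 0).
Proof.
move=> cardF; have ch2 := card_finPcharP cardF isT.
have /eqP := sqr_abs_trace _ n x ch2.
rewrite abs_trace_sqr // -subr_eq0 expr2 -{3}[abs_trace n x]mulr1 -mulrBr.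
rewrite mulf_eq0 subr_eq0 => /orP[] /eqP->; rewrite ?eqxx ?oner_eq0 //.
by rewrite eq_sym oner_eq0.
Qed.

Lemma abs_trace1 (F : finFieldType) (n : nat) :
  2%N \in [pchar F] -> ~~ odd n -> abs_trace n (1 : F) = 0.
Proof.
move=> ch2 /even_halfK <-; rewrite /abs_trace.
under eq_bigr => i _ do rewrite expr1n.
by rewrite sumr_const card_ord -muln2 mulnC mulrnA natr2_pchar2 // mul0rn.
Qed.

Lemma abs_trace_sqrV (F : finFieldType) (n : nat) (x : F) :
  #|F| = (2 ^ n)%N -> abs_trace n (x ^- 2) = abs_trace n x^-1.
Proof. by move=> cardF; rewrite -exprVn abs_trace_sqr. Qed.

Lemma abs_trace_artin_schreier (F : finFieldType) (n : nat) (y : F) :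
  #|F| = (2 ^ n)%N -> abs_trace n (y ^+ 2 + y) = 0.
Proof.
move=> cardF; have ch2 := card_finPcharP cardF isT.
by rewrite abs_traceD // abs_trace_sqr // addrr_pchar2.
Qed.

(* Additive Hilbert 90. *)
Lemma abs_trace_eq0 (F : finFieldType) (n : nat) (c : F) :
    (0 < n)%N -> #|F| = (2 ^ n)%N -> abs_trace n c = 0 ->
  exists y, c = y ^+ 2 + y.
Proof.
case: n => // m _ cardF trc; have ch2 := card_finPcharP cardF isT.
suff imE : [set y ^+ 2 + y | y in [set: F]]
    = [set x : F | abs_trace m.+1 x == 0].
  have : c \in [set y ^+ 2 + y | y in [set: F]] by rewrite imE inE trc.
  by case/imsetP=> y _ ->; exists y.
(* The map y^2 + y is at most two-to-one, so it suffices that the kernel of the trace has at most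
   2^m elements. It does, being the root set of a polynomial of degree 2^m. *)
apply: (imset_eq_fiber_bound _ _ _ _ _ 2) => //.
- by apply/subsetP => _ /imsetP[y _ ->]; rewrite inE abs_trace_artin_schreier.
- rewrite cardsT cardF expnSr leq_mul2r /=.
  pose p : {poly F} := \sum_(i < m.+1) 'X^(2 ^ i).
  have szp : size p = (2 ^ m).+1.
    rewrite /p big_ord_recr /= addrC size_polyDl ?size_polyXn // ltnS.
    apply: (leq_trans (size_sum _ _ _)); apply/bigmax_leqP => i _.
    by rewrite size_polyXn ltn_exp2l.
  apply: leq_trans (card_root_le _ _ _ szp); apply/subset_leq_card/subsetP => x.
  rewrite !inE /root /p horner_sum /abs_trace.
  by under [in X in _ -> X]eq_bigr => i _ do rewrite hornerXn.
move=> y; have szq : size ('X^2 + 'X - y%:P : {poly F}) = 3.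
  rewrite -addrA size_polyDl ?size_polyXn //.
  by rewrite size_XsubC.
apply: leq_trans (card_root_le _ _ _ szq); apply/subset_leq_card/subsetP => x.
by rewrite !inE /root !hornerE subr_eq0.
Qed.

(** * Counting the roots of the cubic *)

Lemma root_cubic (F : finFieldType) (xi x : F) :
  root ('X^3 + 'X - xi%:P) x = (x ^+ 3 + x == xi).
Proof. by rewrite /root !hornerE subr_eq0. Qed.

Lemma cubic_neq0 (F : fieldType) (a : F) :
  2%N \in [pchar F] -> (a ^+ 3 + a != 0) = (a != 0) && (a + 1 != 0).
Proof.
move=> ch2; have h2 := natr2_pchar2 _ ch2.
have -> : a ^+ 3 + a = a * (a + 1) ^+ 2 by ring: h2.
by rewrite mulf_eq0 sqrf_eq0 negb_or.
Qed.

(* Partial fractions: 1/(a (a+1)^2) = 1/a - 1/(a+1) - 1/(a+1)^2. *)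
Lemma abs_trace_inv_cubic (F : finFieldType) (n : nat) (a : F) :
    #|F| = (2 ^ n)%N -> a != 0 -> a + 1 != 0 ->
  abs_trace n (a ^+ 3 + a)^-1 = abs_trace n a^-1.
Proof.
move=> cardF a0 a1; have ch2 := card_finPcharP cardF isT.
have h2 := natr2_pchar2 _ ch2.
have -> : a ^+ 3 + a = a * (a + 1) ^+ 2 by ring: h2.
have -> : (a * (a + 1) ^+ 2)^-1 = a^-1 - ((a + 1)^-1 ^+ 2 + (a + 1)^-1).
  by field; rewrite a1 a0.
by rewrite (oppr_pchar2 ch2) abs_traceD // abs_trace_artin_schreier // addr0.
Qed.

Lemma cubic_collision_trace (F : finFieldType) (n : nat) (a b : F) :
    #|F| = (2 ^ n)%N -> ~~ odd n -> a != 0 -> a != b ->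
    a ^+ 3 + a = b ^+ 3 + b ->
  abs_trace n a^-1 = 0.
Proof.
move=> cardF n_even a0 ab eqab; have ch2 := card_finPcharP cardF isT.
have /eqP : (a - b) * (b ^+ 2 + a * b + a ^+ 2 + 1) = 0.
  transitivity ((a ^+ 3 + a) - (b ^+ 3 + b)); first by ring.
  by rewrite eqab subrr.
rewrite mulf_eq0 subr_eq0 (negPf ab) /= => /eqP q0.
(* Division by a^2 produces an Artin-Schreier expression in b/a. Under the trace it vanishes, as
   does 1 for even n, so only Tr(1/a^2) = Tr(1/a) remains. *)
have : (b / a) ^+ 2 + b / a + 1 + a ^- 2 = 0.
  rewrite -[RHS](mul0r (a ^- 2)) -q0; by field.
move/(congr1 (abs_trace n)); rewrite !abs_traceD // abs_trace_sqr //.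
rewrite addrr_pchar2 // abs_trace1 // !add0r abs_trace_sqrV // => ->.
by rewrite /abs_trace big1 // => i _; rewrite expr0n expn_eq0.
Qed.

Lemma card_cubic_roots3 (F : finFieldType) (n : nat) (a : F) :
    #|F| = (2 ^ n)%N -> (0 < n)%N -> ~~ odd n ->
    a != 0 -> a + 1 != 0 -> abs_trace n a^-1 = 0 ->
  #|[set x : F | x ^+ 3 + x == a ^+ 3 + a]| = 3.
Proof.
move=> cardF n_gt0 n_even a0 a1 tra; have ch2 := card_finPcharP cardF isT.
have h2 := natr2_pchar2 _ ch2.
have tr0 : abs_trace n (1 + a ^- 2) = 0.
  by rewrite abs_traceD // abs_trace1 // abs_trace_sqrV // tra addr0.
have [y yE] := abs_trace_eq0 _ _ _ n_gt0 cardF tr0.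
have {}yE : a ^+ 2 + 1 = a ^+ 2 * (y ^+ 2 + y) by rewrite -yE; field.
(* This excludes y = 0 and y = 1, the only values for which two of the roots a, ay, a(y + 1) would
   coincide. *)
have sq1 : a ^+ 2 + 1 != 0.
  have -> : a ^+ 2 + 1 = (a + 1) ^+ 2 by ring: h2.
  by rewrite sqrf_eq0.
have y0 : y != 0 by apply: contraNneq sq1 => y0; rewrite yE y0; apply/eqP; ring.
have y1 : y + 1 != 0.
  by apply: contraNneq sq1 => y1; rewrite yE sqrD_id y1 !mulr0.
have -> : [set x : F | x ^+ 3 + x == a ^+ 3 + a]
    = [set x in [:: a; a * y; a * (y + 1)]].
  apply/setP => x; rewrite !inE -subr_eq0.
  have -> : x ^+ 3 + x - (a ^+ 3 + a)
      = (x - a) * ((x - a * y) * (x - a * (y + 1))).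
    transitivity ((x - a) * (x ^+ 2 + a * x + (a ^+ 2 + 1))); first by ring.
    (* The explicit multiple of 2 turns the factorization into an identity of commutative rings,
       once a^2 + 1 is replaced using [yE]. *)
    transitivity ((x - a) * ((x - a * y) * (x - a * (y + 1))
                             + 2 * (a * x * y + a * x))).
      by rewrite yE; ring.
    by rewrite h2 mul0r addr0.
  by rewrite !mulf_eq0 !subr_eq0.
rewrite cardsE -{1}[a]mulr1; apply/(card_uniqP (s := map _ [:: 1; y; y + 1])).
rewrite map_inj_uniq; last exact: mulfI.
rewrite /= !inE andbT negb_or -subr_eq0 (oppr_pchar2 ch2) addrC y1 /=.
rewrite -subr_eq0 opprD addrCA subrr addr0 oppr_eq0 y0 /=.
by rewrite -subr_eq0 opprD addrA subrr sub0r oppr_eq0 oner_neq0.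
Qed.

Lemma card_cubic_roots_neq0 (F : finFieldType) (n : nat) (a : F) :
    #|F| = (2 ^ n)%N -> (0 < n)%N -> ~~ odd n -> a ^+ 3 + a != 0 ->
  #|[set x : F | x ^+ 3 + x == a ^+ 3 + a]|
    = if abs_trace n a^-1 == 1 then 1 else 3.
Proof.
move=> cardF n_gt0 n_even xi0; have ch2 := card_finPcharP cardF isT.
move: (xi0); rewrite cubic_neq0 // => /andP[a0 a1].
case: ifPn => [/eqP tra|]; last first.
  rewrite abs_trace_neq1 // => /eqP tra; exact: card_cubic_roots3 tra.
apply/eqP/cards1P; exists a; apply/setP => x; rewrite !inE.
apply/eqP/eqP => [eqxa|-> //]; apply/eqP; rewrite eq_sym.
apply/negP => /negP ax; have /eqP := oner_neq0 F; apply; rewrite -tra.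
by apply: cubic_collision_trace ax _.
Qed.

Lemma trace1_cubic_onto (F : finFieldType) (n : nat) (xi : F) :
    #|F| = (2 ^ n)%N -> ~~ odd n -> xi != 0 -> abs_trace n xi^-1 = 1 ->
  exists a, xi = a ^+ 3 + a.
Proof.
move=> cardF n_even xi0 trxi; have ch2 := card_finPcharP cardF isT.
pose A := [set a : F | (a != 0) && (abs_trace n a^-1 == 1)].
have /eqP fA : [set a ^+ 3 + a | a in A] == A.
  rewrite eqEcard; apply/andP; split.
    apply/subsetP => b /imsetP[a]; rewrite inE => /andP[a0 tra] ->.
    (* Since Tr(1) = 0 for even n, the element 1 is not in [A]; hence the cubic is nonzero at a and
       the partial fractions apply. *)
    have a1 : a + 1 != 0.
      apply/negP => aE; move: tra; rewrite addr_eq0 (oppr_pchar2 ch2) in aE.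
      by rewrite (eqP aE) invr1 abs_trace1 // eq_sym oner_eq0.
    by rewrite inE cubic_neq0 // a0 a1 abs_trace_inv_cubic.
  rewrite card_in_imset // => a b; rewrite !inE => /andP[a0 /eqP tra] _ eqab.
  apply/eqP/negP => /negP ab; have /eqP := oner_neq0 F; apply; rewrite -tra.
  exact: cubic_collision_trace ab eqab.
have : xi \in A by rewrite inE xi0 trxi eqxx.
by rewrite -fA => /imsetP[a _ ->]; exists a.
Qed.

(** * The parametrization by r + 1/r, and cubes *)

Lemma cubic_addV (F : fieldType) (r : F) :
    2%N \in [pchar F] -> r != 0 ->
  (r + r^-1) ^+ 3 + (r + r^-1) = r ^+ 3 + r ^- 3.
Proof.
move=> /natr2_pchar2 h2 r0.
(* This is the Dickson identity: r + 1/r is sent to r^3 + 1/r^3 by X^3 - 3X, which is X^3 + X modulo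
   2. *)
transitivity (r ^+ 3 + r ^- 3 + 2 * 2 * (r + r^-1)); first by field.
by rewrite h2 !mul0r addr0.
Qed.

(* If 1/a = y^2 + y, then a = r + 1/r for r = 1 + 1/y. *)
Lemma trace0_cubeD (F : finFieldType) (n : nat) (a : F) :
    #|F| = (2 ^ n)%N -> (0 < n)%N -> a != 0 -> abs_trace n a^-1 = 0 ->
  exists2 r, r != 0 & a ^+ 3 + a = r ^+ 3 + r ^- 3.
Proof.
move=> cardF n_gt0 a0 tra; have ch2 := card_finPcharP cardF isT.
have h2 := natr2_pchar2 _ ch2.
have [y yE] := abs_trace_eq0 _ _ _ n_gt0 cardF tra.
have : y ^+ 2 + y != 0 by rewrite -yE invr_eq0.
rewrite sqrD_id mulf_eq0 negb_or => /andP[y0 y1].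
exists ((y + 1) / y); first by rewrite mulf_neq0 ?invr_eq0.
rewrite -cubic_addV ?mulf_neq0 ?invr_eq0 //.
suff <- : a = (y + 1) / y + ((y + 1) / y)^-1 by [].
(* In every characteristic, (y + 1)/y + y/(y + 1) = 1/(y^2 + y) + 2. *)
rewrite -[LHS]invrK yE; transitivity ((y ^+ 2 + y)^-1 + 2).
  by rewrite h2 addr0.
by rewrite sqrD_id; field; rewrite y0 y1.
Qed.

(** For a = r + 1/r one has 1/a = r/(r + 1)^2 = z^2 + z with z = 1/(r + 1), and such elements have
    trace 0. *)
Lemma cubeD_trace0 (F : finFieldType) (n : nat) (r : F) :
    #|F| = (2 ^ n)%N -> r != 0 -> r ^+ 3 + r ^- 3 != 0 ->
  exists2 a, r ^+ 3 + r ^- 3 = a ^+ 3 + a & abs_trace n a^-1 = 0.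
Proof.
move=> cardF r0; have ch2 := card_finPcharP cardF isT.
have h2 := natr2_pchar2 _ ch2.
rewrite -cubic_addV // cubic_neq0 // => /andP[a0 _]; exists (r + r^-1) => //.
have aE : r + r^-1 = (r + 1) ^+ 2 / r.
  transitivity ((r + 1) ^+ 2 / r - 2); first by field.
  by rewrite h2 subr0.
have r1 : r + 1 != 0.
  by apply: contraNneq a0 => r1; rewrite aE r1 expr0n mul0r.
rewrite aE invf_div -(abs_trace_artin_schreier _ _ (r + 1)^-1 cardF).
congr abs_trace; transitivity ((r + 1)^-1 ^+ 2 + (r + 1)^-1 - 2 * (r + 1) ^- 2).
  by field.
by rewrite h2 mul0r subr0.
Qed.

(** A count replaces the choice of a generator: cubing is at most three-to-one on the 3m nonzero
    elements, and there are at most m roots of X^m - 1. *)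
Lemma cubes_unity_roots (F : finFieldType) (m : nat) :
  #|F| = (3 * m).+1 -> [set r ^+ 3 | r in [set~ (0 : F)]] = Uroots F m.
Proof.
move=> cardF; have m_gt0 : (0 < m)%N.
  by case: m cardF => // cardF; have := finNzRing_gt1 F; rewrite cardF.
apply: (imset_eq_fiber_bound _ _ _ _ _ 3) => //.
- apply/subsetP => s /imsetP[r]; rewrite !inE => r0 ->.
  (* Multiplied by r, the claim r^(3m) = 1 becomes r^(3m + 1) = r, where 3m + 1 is the order of the
     field. *)
  rewrite -exprM -(inj_eq (mulfI r0)) -exprS -cardF mulr1.
  by rewrite expf_card.
- rewrite cardsC1 cardF /= mulnC leq_mul2l /=.
  have szp : size ('X^m - 1 : {poly F}) = m.+1 by rewrite size_XnsubC.
  apply: leq_trans (card_root_le _ _ _ szp); apply/subset_leq_card/subsetP => x.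
  by rewrite !inE /root !hornerE subr_eq0.
move=> y; have szq : size ('X^3 - y%:P : {poly F}) = 4 by rewrite size_XnsubC.
apply: leq_trans (card_root_le _ _ _ szq); apply/subset_leq_card/subsetP => x.
by rewrite !inE /root !hornerE subr_eq0 => /andP[].
Qed.

(** The factorization x(x + 1)^2 leaves the roots 0 and 1. This keeps 0 out of [Yset F 1] and
    [Yset F 3]. *)
Lemma card_cubic_roots_at0 (F : finFieldType) :
  2%N \in [pchar F] -> #|[set x : F | x ^+ 3 + x == 0]| = 2.
Proof.
move=> ch2; rewrite -[RHS](_ : #|[set (0 : F); 1]| = 2).
  apply: eq_card => x; rewrite !inE; apply: negb_inj.
  by rewrite cubic_neq0 // addr_eq0 (oppr_pchar2 ch2) negb_or.
by rewrite cards2 eq_sym oner_eq0.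
Qed.

(** For even n, 2^n is a power of 4, and 4 is 1 modulo 3. *)
Lemma pow2_even_mod3 (n : nat) :
  ~~ odd n -> (2 ^ n)%N = (3 * ((2 ^ n - 1) %/ 3)).+1.
Proof.
move=> n_even; have d3 : (3 %| 2 ^ n - 1)%N.
  rewrite -eqn_mod_dvd ?expn_gt0 // -(even_halfK n_even) -mul2n expnM.
  by rewrite -modnXm exp1n.
by rewrite mulnC divnK // subn1 prednK ?expn_gt0.
Qed.

Theorem theorem3 (n : nat) (F : finFieldType)
    (n_gt0 : (0 < n)%N) (n_even : ~~ odd n) (cardF : #|F| = (2 ^ n)%N) :
  [/\ cubic_image F = [set 0] :|: Yset F 1 :|: Yset F 3,
      [/\ [disjoint [set 0] & Yset F 1],
          [disjoint [set 0] & Yset F 3]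
        & [disjoint Yset F 1 & Yset F 3]],
      Yset F 1 = [set xi : F | (xi != 0) && (abs_trace n xi^-1 == 1)],
      Yset F 3 = [set r ^+ 3 + r ^- 3 | r : F & r != 0] :\ 0
    & [set r ^+ 3 + r ^- 3 | r : F & r != 0]
        = [set s + s^-1 | s in Uroots F ((2 ^ n - 1) %/ 3)]].
Proof.
have ch2 := card_finPcharP cardF isT.
have YE i xi : (xi \in Yset F i) = (#|[set x : F | x ^+ 3 + x == xi]| == i).
  rewrite inE; congr (#|pred_of_set _| == i).
  by apply/setP => x; rewrite !inE root_cubic.
have Y0 i : (0 \in Yset F i) = (i == 2).
  by rewrite YE card_cubic_roots_at0 // eq_sym.
(* Any one root a of the cubic decides the number of roots; below, each xi is first written as a^3 +
   a. *)
have Ycubic i (a : F) : a ^+ 3 + a != 0 ->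
    (a ^+ 3 + a \in Yset F i) = (i == if abs_trace n a^-1 == 1 then 1 else 3).
  by move=> xi0; rewrite YE (card_cubic_roots_neq0 _ n) // eq_sym.
have Yroot i xi : (0 < i)%N -> xi \in Yset F i -> exists a : F, xi = a ^+ 3 + a.
  move=> i_gt0; rewrite YE => /eqP iE; rewrite -iE in i_gt0.
  by case/card_gt0P: i_gt0 => a; rewrite inE => /eqP <-; exists a.
split.
- apply/setP => xi; rewrite 2!in_setU in_set1 -!orbA.
  apply/imsetP/or3P => [[a _ ->]|].
    have [->|xi0] := eqVneq (a ^+ 3 + a) 0; first exact: Or31.
    have := Ycubic _ a xi0; case: ifP => _ Ya.
      by apply: Or32; rewrite Ya.
    by apply: Or33; rewrite Ya.
  case=> [/eqP->|/(Yroot 1)|/(Yroot 3)]; last 2 first.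
  + by case=> // a ->; exists a.
  + by case=> // a ->; exists a.
  by exists 0 => //; rewrite expr0n addr0.
- split; rewrite ?disjoints1 ?Y0 //.
  rewrite disjoint_subset; apply/subsetP => xi; rewrite YE => /eqP Y1.
  by rewrite inE /= YE Y1.
- apply/setP => xi; apply/idP/idP => [Yxi|]; rewrite inE.
    have xi0 : xi != 0 by apply: contraTneq Yxi => ->; rewrite Y0.
    have [a xiE] := Yroot 1 _ isT Yxi; rewrite xi0; move: xi0 Yxi.
    rewrite {}xiE => xi0; rewrite Ycubic //; move: xi0; rewrite cubic_neq0 //.
    by case/andP=> a0 a1; rewrite abs_trace_inv_cubic //; case: ifP.
  (* Here the existence of a root is not given; it comes from the bijectivity of the cubic on the
     elements whose inverse has trace 1. *)
  case/andP=> xi0 /eqP trxi.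
  have [a xiE] := trace1_cubic_onto _ _ _ cardF n_even xi0 trxi.
  rewrite xiE in xi0 trxi *; rewrite Ycubic //.
  move: xi0; rewrite cubic_neq0 //.
  by case/andP=> a0 a1; rewrite -(abs_trace_inv_cubic _ n a) // trxi eqxx.
- apply/setP => xi; rewrite [RHS]in_setD1; apply/idP/andP => [Yxi|].
    have xi0 : xi != 0 by apply: contraTneq Yxi => ->; rewrite Y0.
    split=> //; have [a xiE] := Yroot 3 _ isT Yxi; rewrite xiE in xi0 Yxi *.
    have := xi0; rewrite cubic_neq0 // => /andP[a0 _].
    move: Yxi; rewrite Ycubic //; case: ifPn => //; rewrite abs_trace_neq1 //.
    move=> /eqP tra _; have [r r0 ->] := trace0_cubeD _ _ _ cardF n_gt0 a0 tra.
    by apply/imsetP; exists r; rewrite ?inE.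
  case=> xi0 /imsetP[r]; rewrite inE => r0 xiE; rewrite xiE in xi0 *.
  have [a aE tra] := cubeD_trace0 _ _ _ cardF r0 xi0.
  by rewrite aE in xi0 *; rewrite Ycubic // tra [0 == _]eq_sym oner_eq0.
(* The substitution s = r^3 matches the two parametrizations. *)
rewrite -cubes_unity_roots; last by rewrite cardF -pow2_even_mod3.
rewrite -imset_comp; apply/setP => xi; apply/imsetP/imsetP.
  by case=> r r0 ->; exists r; rewrite // !inE in r0 *.
by case=> r r0 ->; exists r; rewrite // !inE in r0 *.
Qed.
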